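(* Let $\mathcal{R}$ be a finite-dimensional non-nilpotent complex solvable Lie superalgebra with nilradical $\mathcal{N}=\mathcal{N}_0\oplus\mathcal{N}_1$ such that $[\mathcal{R},\mathcal{R}]\subseteq\mathcal{N}$, and write $\mathcal{R}=\mathcal{N}_0\oplus\mathcal{N}_1\oplus\mathcal{Q}_0^1\oplus\mathcal{Q}_0^2$, where $\mathcal{Q}_0=\mathcal{Q}_0^1\oplus\mathcal{Q}_0^2$ is an even complementary subspace to $\mathcal{N}$ decomposed as described in the context. Then $$\dim\mathcal{Q}_0^1\leq\dim\Big(\mathcal{N}_0/\big([\mathcal{N}_0,\mathcal{N}_0]+[\mathcal{N}_1,\mathcal{N}_1]\big)\Big)\quad\text{and}\quad\dim\mathcal{Q}_0^2\leq\dim\big(\mathcal{N}_1/[\mathcal{N}_1,\mathcal{N}_0]\big).$$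
   Context: A Lie superalgebra $\mathcal{L}=\mathcal{L}_0\oplus\mathcal{L}_1$ is a $\mathbb{Z}_2$-graded vector space with an even bilinear bracket satisfying super skew-symmetry and the super Jacobi identity. The nilradical is the maximal nilpotent ideal. Put $ad_z(y)=[y,z]$. When $[\mathcal{R},\mathcal{R}]\subseteq\mathcal{N}$, every graded complement of $\mathcal{N}$ in $\mathcal{R}$ is purely even, so $\mathcal{R}=\mathcal{N}\oplus\mathcal{Q}_0$ with $\mathcal{Q}_0\subseteq\mathcal{R}_0$. Let $x_1,\dots,x_k$ (even) and $y_1,\dots,y_s$ (odd) be the generator basis elements of $\mathcal{N}$, i.e. homogeneous basis elements whose images form a basis of $\mathcal{N}/[\mathcal{N},\mathcal{N}]$, in a basis of $\mathcal{N}$ adapted to the lower central series, and let $X=\mathrm{Span}\{x_1,\dots,x_k\}$. For $z\in\mathcal{Q}_0$, ${ad_z}_{|X}$ denotes the restriction of $ad_z$ to $X$ followed by projection onto $X$ along $[\mathcal{N}_0,\mathcal{N}_0]+[\mathcal{N}_1,\mathcal{N}_1]$ (equivalently, the map induced on $\mathcal{N}_0/([\mathcal{N}_0,\mathcal{N}_0]+[\mathcal{N}_1,\mathcal{N}_1])$). Then $\mathcal{Q}_0^2=\{z\in\mathcal{Q}_0 \mid {ad_z}_{|X}\text{ is nilpotent}\}$, and $\mathcal{Q}_0^1$ is a complementary subspace to $\mathcal{Q}_0^2$ in $\mathcal{Q}_0$. *)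

(* Defs.v *)
From HB Require Import structures.
From mathcomp Require Import all_boot all_order all_algebra.
From mathcomp Require Import reals.
From mathcomp Require Import complex.

Set Implicit Arguments.
Unset Strict Implicit.
Unset Printing Implicit Defensive.

Import GRing.Theory.

Local Open Scope ring_scope.

(* Z/2 is [bool] with addition [(+)]: [grade false] is the even part L_0 and
   [grade true] the odd part L_1.  [K] is a [numFieldType] so that the
   characteristic is 0; in characteristics 2 and 3 these axioms are too weak. *)
HB.mixin Record Vector_isLieSuperalgebra (K : numFieldType) L
    of Vector K L := {
  grade : bool -> {vspace L};
  bracket : L -> L -> L;
  grade_sum : (grade false + grade true)%VS = fullv;
  grade_cap : (grade false :&: grade true)%VS = 0%VS;
  bracket_linearl : forall y, linear (bracket^~ y);
  bracket_linearr : forall x, linear (bracket x);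
  bracket_grade : forall i j x y, x \in grade i -> y \in grade j ->
    bracket x y \in grade (i (+) j);
  bracket_skew : forall i j x y, x \in grade i -> y \in grade j ->
    bracket x y = - ((-1) ^+ (i && j) *: bracket y x);
  bracket_jacobi : forall i j k x y z,
    x \in grade i -> y \in grade j -> z \in grade k ->
    (-1) ^+ (i && k) *: bracket x (bracket y z)
    + (-1) ^+ (j && i) *: bracket y (bracket z x)
    + (-1) ^+ (k && j) *: bracket z (bracket x y) = 0
}.

#[short(type="lieSuperalgType")]
HB.structure Definition LieSuperalgebra (K : numFieldType) :=
  {L of Vector_isLieSuperalgebra K L & Vector K L}.

Arguments grade {K L} : rename.
Arguments bracket {K L} : rename.

Section LieSuperalgebraTheory.
Variables (K : numFieldType) (L : lieSuperalgType K).
Implicit Types (U W I N : {vspace L}) (x y z : L) (e : seq L).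

Definition bracketr y x := bracket x y.

HB.instance Definition _ y :=
  GRing.isLinear.Build K L L *:%R (bracketr y) (@bracket_linearl K L y).
HB.instance Definition _ x :=
  GRing.isLinear.Build K L L *:%R (bracket x) (@bracket_linearr K L x).

Definition ad z : 'End(L) := linfun (bracketr z).

Lemma adE z y : ad z y = bracket y z.
Proof. by rewrite lfunE. Qed.

Definition bracketv U W : {vspace L} :=
  <<[seq bracket u w | u <- vbasis U, w <- vbasis W]>>%VS.

Lemma memv_bracket U W u w :
  u \in U -> w \in W -> bracket u w \in bracketv U W.
Proof.
move=> /coord_vbasis -> /coord_vbasis ->.
rewrite -/(bracketr _ _) linear_sum rpred_sum // => i _.
rewrite linearZ_LR rpredZ //= /bracketr linear_sum rpred_sum // => j _.
rewrite linearZ_LR rpredZ // memv_span //.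
by apply/allpairsP; exists ((vbasis U)`_i, (vbasis W)`_j);
  split=> //=; rewrite mem_nth ?size_tuple.
Qed.

Lemma bracketv_sub U W I :
  {in U & W, forall u w, bracket u w \in I} -> (bracketv U W <= I)%VS.
Proof.
move=> sub_I; apply/span_subvP => _ /allpairsP[[u w] /= [Uu Ww ->]].
by apply: sub_I; apply: vbasis_mem.
Qed.

(* [lcs U n] is U^(n+1) and [derived_series U n] is U^[n+1] in the usual
   one-based numbering; in particular [lcs U 1] is [U, U]. *)
Definition lcs U n : {vspace L} := iter n (fun W => bracketv W U) U.
Definition derived_series U n : {vspace L} := iter n (fun W => bracketv W W) U.

Definition nilpotent U : Prop := exists n, lcs U n = 0%VS.
Definition solvable U : Prop := exists n, derived_series U n = 0%VS.

Definition evenpart U : {vspace L} := (U :&: grade false)%VS.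
Definition oddpart U : {vspace L} := (U :&: grade true)%VS.

Definition graded U : Prop := U = (evenpart U + oddpart U)%VS.

(* For graded subspaces, left, right and two-sided ideals coincide. *)
Definition ideal I : Prop := graded I /\ (bracketv I fullv <= I)%VS.

Definition nilradical N : Prop :=
  [/\ ideal N, nilpotent N &
      forall I, ideal I -> nilpotent I -> (N <= I)%VS -> I = N].

Definition complementv U W V : Prop :=
  (U + W)%VS = V /\ (U :&: W)%VS = 0%VS.

Definition homogeneous x : bool := (x \in grade false) || (x \in grade true).

(* A homogeneous basis of N containing a basis of every term of the lower
   central series of N. *)
Definition adapted_basis N e : Prop :=
  [/\ basis_of N e, all homogeneous e &
      forall n, basis_of (lcs N n) [seq v <- e | v \in lcs N n]].

(* In an adapted basis, the generators are the elements outside [N, N]: their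
   images form a basis of N / [N, N]. *)
Definition even_generators N e : seq L :=
  [seq v <- e | (v \in grade false) && (v \notin bracketv N N)].

Definition even_decomposables N : {vspace L} :=
  (bracketv (evenpart N) (evenpart N) + bracketv (oddpart N) (oddpart N))%VS.

(* With X spanned by the even generators, this maps X to itself and its
   restriction to X is ad_z|X: ad_z followed by the projection onto X along
   [N_0, N_0] + [N_1, N_1], which is complementary to X in N_0. *)
Definition ad_gen N e z : 'End(L) :=
  (daddv_pi <<even_generators N e>> (even_decomposables N) \o ad z)%VF.

Definition nilpotent_on U (f : 'End(L)) : Prop :=
  exists n, {in U, forall x, iter n f x = 0}.

End LieSuperalgebraTheory.

Section QuotientSpace.
Variables (K : fieldType) (V : vectType K).
Implicit Types U W : {vspace V}.

(* The quotient V / W, modelled on a complement of W; [quot_pi] is the canonical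
   projection, a surjection with kernel W. *)
Definition quot_space W : vectType K := subvs_of (W^C)%VS.

Definition quot_pi W : 'Hom(V, quot_space W) :=
  (linfun (vsproj (W^C)%VS) \o daddv_pi (W^C)%VS W)%VF.

(* For W <= U, the subspace U / W of V / W. *)
Definition quotv U W : {vspace quot_space W} := (quot_pi W @: U)%VS.

Lemma lker_quot_pi W : lker (quot_pi W) = W.
Proof.
have capCW : (W^C :&: W = 0)%VS by rewrite capvC capv_compl.
apply/vspaceP=> v; rewrite memv_ker comp_lfunE lfunE /=.
rewrite -(inj_eq val_inj) /= vsprojK ?memv_pi //.
have /(daddv_pi_add capCW) dv : v \in (W^C + W)%VS.
  by rewrite addvC addv_complf memvf.
apply/eqP/idP=> [pv0|Wv]; first by rewrite -dv pv0 add0r memv_pi.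
move: dv; rewrite (daddv_pi_id _ Wv) ?capv_compl // => dv.
by apply: (addIr v); rewrite add0r.
Qed.

Lemma limg_quot_pi W : limg (quot_pi W) = fullv.
Proof.
apply/vspaceP=> u; rewrite memvf; apply/memv_imgP; exists (vsval u).
  exact: memvf.
rewrite comp_lfunE lfunE /= daddv_pi_id ?subvsP ?vsvalK //.
by rewrite capvC capv_compl.
Qed.

Lemma dimv_quotv U W : (W <= U)%VS -> \dim (quotv U W) = (\dim U - \dim W)%N.
Proof.
move=> sWU; have := limg_ker_dim (quot_pi W) U.
by rewrite lker_quot_pi (capv_idPr sWU) => <-; rewrite addKn.
Qed.

End QuotientSpace.

(* Main.v *)
(** Elements of [Q_0] act on [N_0 / ([N_0, N_0] + [N_1, N_1])] and on
    [N_1 / [N_1, N_0]] by commuting operators, because [[R, R]] lies in [N].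
    Commuting operators are simultaneously triangular, so a space of them with no
    nonzero nilpotent elements is at most as large as the number of diagonal
    weights, the dimension of the module.  On [Q_0^1] no nonzero element is
    nilpotent on the even quotient by the choice of [Q_0^2].  On [Q_0^2], an
    element [z] that is nilpotent on the odd quotient too is nilpotent on
    [N / [N, N]], hence, being an even derivation, on every factor of the lower
    central series of [N]; then [N + <z>] is a nilpotent ideal, so [z] is in [N]
    by maximality and [z = 0]. *)

From HB Require Import structures.
Require Import Defs.
From mathcomp Require Import all_boot all_order all_algebra.
From mathcomp Require Import reals.
From mathcomp Require Import complex.

Set Implicit Arguments.
Unset Strict Implicit.
Unset Printing Implicit Defensive.

Import GRing.Theory passmx.

Local Open Scope ring_scope.

(** * Nilpotent combinations of commuting operators *)

Lemma trig_mx_nilpotent (F : fieldType) n (A : 'M[F]_n) :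
  is_trig_mx A -> (forall i, A i i = 0) -> A ^+ n = 0.
Proof.
case: n A => [|n] A trigA diagA; first exact: flatmx0.
(* With zero diagonal the characteristic polynomial is a power of ['X]. *)
have := Cayley_Hamilton A.
rewrite char_poly_trig // (eq_bigr (fun=> 'X)) => [|i _]; last first.
  by rewrite diagA subr0.
by rewrite prodr_const card_ord rmorphXn /= horner_mx_X.
Qed.

Section CommutingMatrices.
Variables (C : numClosedFieldType) (n d : nat) (M : 'I_d -> 'M[C]_n).

(** After simultaneous triangularization, the [d] diagonals are vectors of a space of dimension
    [n < d], hence linearly dependent; a dependency makes the combination strictly triangular. *)
Lemma comm_mx_nilpotent_comb :
    (forall i j, comm_mx (M i) (M j)) -> (n < d)%N ->
  exists2 c : 'rV[C]_d, c != 0 & (\sum_i c 0 i *: M i) ^+ n = 0.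
Proof.
move=> commM lt_nd.
have [|P uP /allP trigP] := @cotrigonalization C n (codom M).
  by move=> _ _ /codomP[i ->] /codomP[j ->]; apply: commM.
have {}uP : P \in unitmx by apply: unitarymx_unit.
pose T i := P *m M i *m invmx P.
have trigT i : is_trig_mx (T i).
  by have := trigP _ (codom_f M i); rewrite /= /similar_to conjumx.
(* The rows of [G] are the diagonals; a dependency among them is a nonzero vector of its left
   kernel. *)
pose G : 'M[C]_(d, n) := \matrix_(i, j) T i j j.
have [c c0 cG] : exists2 c : 'rV[C]_d, c != 0 & c *m G = 0.
  have kerG0 : kermx G != 0.
    rewrite -mxrank_eq0 mxrank_ker subn_eq0 -ltnNge.
    exact: leq_ltn_trans (rank_leq_col G) lt_nd.
  by have /rowV0Pn[c /sub_kermxP ? ?] := kerG0; exists c.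
exists c => //; set S := \sum_i _.
have defS : P *m S *m invmx P = \sum_i c 0 i *: T i.
  rewrite mulmx_sumr mulmx_suml; apply: eq_bigr => i _.
  by rewrite -scalemxAr -scalemxAl.
have S0 : (P *m S *m invmx P) ^+ n = 0.
  apply: trig_mx_nilpotent => [|j]; rewrite defS.
    apply/is_trig_mxP => i j lt_ij; rewrite summxE big1 // => k _.
    by rewrite mxE (is_trig_mxP (trigT k)) ?mulr0.
  rewrite summxE; transitivity ((c *m G) 0 j); last by rewrite cG mxE.
  by rewrite [RHS]mxE; apply: eq_bigr => i _; rewrite [LHS]mxE [G i j]mxE.
have conjX k : (P *m S *m invmx P) ^+ k = P *m S ^+ k *m invmx P.
  elim: k => [|k IHk]; first by rewrite !expr0 mulmx1 mulmxV.
  by rewrite !exprS IHk -!mulmxE !mulmxA mulmxKV.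
have : invmx P *m (P *m S ^+ n *m invmx P) *m P = 0.
  by rewrite -conjX S0 mulmx0 mul0mx.
by rewrite !mulmxA mulVmx // mul1mx mulmxKV.
Qed.

End CommutingMatrices.

Section CommutingEndomorphisms.
Variables (C : numClosedFieldType) (V : vectType C).

Lemma comm_lfun_nilpotent_comb d (F : 'I_d -> 'End(V)) :
    (forall i j, (F i \o F j = F j \o F i)%VF) -> (\dim {:V} < d)%N ->
  exists2 c : 'rV[C]_d, c != 0 &
    exists m, forall x, iter m (\sum_i c 0 i *: F i) x = 0.
Proof.
move=> commF ltVd; pose e := vbasis {:V}.
have e_basis : basis_of {:V} e := vbasisP _.
have [|c c0 cM] :=
    @comm_mx_nilpotent_comb C _ d (fun i => mxof e e (F i)) _ ltVd.
  by move=> i j; rewrite /comm_mx -!mxof_comp // commF.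
exists c => //; exists (\dim {:V}) => x; set S := \sum_i _.
have cM' : mxof e e S ^+ \dim {:V} = 0.
  rewrite -cM linear_sum; congr (_ ^+ _).
  by apply: eq_bigr => i _; rewrite linearZ.
have iterS k : rVof e (iter k S x) = rVof e x *m mxof e e S ^+ k.
  elim: k => [|k IHk]; first by rewrite expr0 mulmx1.
  by rewrite iterS (rVof_app _ e_basis) IHk -mulmxA mulmxE -exprSr.
by apply/eqP; rewrite -(rVof_eq0 e_basis) iterS cM' mulmx0.
Qed.

End CommutingEndomorphisms.

(** * Operators on a quotient, modelled on a complement *)

Section ModuloComplement.
Variables (K : fieldType) (V : vectType K) (T W : {vspace V}).
Hypothesis capTW : (T :&: W = 0)%VS.
Let p := daddv_pi T W.

Lemma daddv_pi_mod x : x \in (T + W)%VS -> p x - x \in W.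
Proof.
move=> /(daddv_pi_add capTW) {2}<-.
by rewrite opprD addrA subrr add0r rpredN memv_pi.
Qed.

Lemma daddv_pi_eq0 x : x \in W -> p x = 0.
Proof.
move=> Wx; have /(daddv_pi_add capTW) : x \in (T + W)%VS.
  by rewrite (subvP (addvSr _ _)).
rewrite (daddv_pi_id _ Wx) ?(capvC W) //.
by move/(canRL (addrK _)); rewrite subrr.
Qed.

Lemma iter_lfunD (f : 'End(V)) k : {morph iter k f : x y / x + y}.
Proof. by move=> x y; elim: k => //= k ->; rewrite linearD. Qed.

Variable f : 'End(V).
Hypothesis stabU : {in (T + W)%VS, forall x, f x \in (T + W)%VS}.
Hypothesis stabW : {in W, forall x, f x \in W}.

(** [p x] and [x] differ by an element of [W], which [f] preserves and [p] kills. *)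
Lemma daddv_pi_lfun x : x \in (T + W)%VS -> p (f (p x)) = p (f x).
Proof.
move=> Ux; apply/subr0_eq.
have Wfx : f (p x - x) \in W by rewrite stabW ?daddv_pi_mod.
by rewrite -(daddv_pi_eq0 Wfx) !linearB.
Qed.

(** [T] is a model of [(T + W) / W] on which [p \o f] is the operator induced by [f], so the same
    exponent serves on both sides. *)
Lemma comp_daddv_pi_nilpotent m :
  {in T, forall x, iter m (p \o f)%VF x = 0} <->
  {in (T + W)%VS, forall x, iter m f x \in W}.
Proof.
have sTU := subvP (addvSl T W).
have iterU k x : x \in (T + W)%VS -> iter k f x \in (T + W)%VS.
  by move=> Ux; elim: k => //= k; apply: stabU.
have iterp k x : x \in T -> iter k (p \o f)%VF x = p (iter k f x).
  move=> Tx; elim: k => [|k IHk] /=; first by rewrite daddv_pi_id.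
  by rewrite IHk comp_lfunE /= daddv_pi_lfun ?iterU ?sTU.
split=> [nil_pf x Ux | nil_f x Tx]; last first.
  by rewrite iterp // daddv_pi_eq0 // nil_f ?sTU.
have Tpx : p x \in T by apply: memv_pi.
have -> : x = p x - (p x - x) by rewrite subKr.
rewrite iter_lfunD rpredD //.
  have := daddv_pi_mod (iterU m _ (sTU _ Tpx)).
  by rewrite -iterp // nil_pf // add0r rpredN.
have : - (p x - x) \in W by rewrite rpredN daddv_pi_mod.
by elim: (m) => //= k IHk /IHk; apply: stabW.
Qed.

End ModuloComplement.

(** * The dimension bound for a space of operators commuting on a quotient *)

Section CommutingOnQuotient.
Variables (C : numClosedFieldType) (V A : vectType C).
Variables (D : {linear A -> 'End(V)}).
Variables (Q : {vspace A}) (U W : {vspace V}).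

(** If [\dim Q] exceeded the dimension of [U / W], a basis of [Q] would give too many commuting
    operators on [U / W]; a nilpotent combination of them comes from a nonzero [z] in [Q], against
    the last hypothesis. *)
Lemma dim_comm_quot_le :
    (W <= U)%VS ->
    {in Q & U, forall z x, D z x \in U} ->
    {in Q & W, forall z x, D z x \in W} ->
    {in Q & Q & U, forall y z x, D y (D z x) - D z (D y x) \in W} ->
    {in Q, forall z, (exists m, {in U, forall x, iter m (D z) x \in W}) ->
       z = 0} ->
  (\dim Q <= \dim (quotv U W))%N.
Proof.
move=> sWU stabU stabW commQ nilQ; rewrite dimv_quotv //.
pose T := (U :\: W)%VS.
have capTW : (T :&: W = 0)%VS by apply: capv_diff.
have sTU : (T <= U)%VS by apply: diffvSl.
have dimT : \dim {:subvs_of T} = (\dim U - \dim W)%N.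
  rewrite dimvf /dim /=.
  by rewrite -(dimv_cap_compl U W) (capv_idPr sWU) addKn.
rewrite -dimT leqNgt; apply/negP => ltQ.
have defU : (T + W)%VS = U.
  by rewrite -[RHS](addv_diff_cap U W) (capv_idPr sWU).
pose p := daddv_pi T W.
(* [F z] is the operator that [D z] induces on [T], the model of [U / W]. *)
have [F FE] : exists F : A -> 'End(subvs_of T),
    forall z t, vsval (F z t) = p (D z (vsval t)).
  exists (fun z => linfun (vsproj T) \o p \o D z \o linfun vsval)%VF => z t.
  by rewrite !comp_lfunE !lfunE /= vsprojK // memv_pi.
have pD z x : z \in Q -> x \in U -> p (D z (p x)) = p (D z x).
  move=> Qz Ux; apply: daddv_pi_lfun; rewrite ?defU // => y Wy.
  exact: stabW.
pose b := vbasis Q.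
(* Here [i] is any natural number: beyond the basis the default value 0 is in [Q] as well. *)
have Qb i : b`_i \in Q.
  have [ltiQ|leQi] := ltnP i (\dim Q).
    by rewrite vbasis_mem // mem_nth // size_tuple.
  by rewrite nth_default ?mem0v // size_tuple.
have [|c c0 [m nilc]] :=
    @comm_lfun_nilpotent_comb C (subvs_of T) (\dim Q) (fun i => F b`_i) _ ltQ.
  move=> i j; apply/lfunP => t; apply: val_inj.
  have FF z z' : vsval ((F z \o F z')%VF t) = p (D z (p (D z' (vsval t)))).
    by rewrite comp_lfunE !FE.
  rewrite /= !FF.
  have Ut := subvP sTU _ (subvsP t).
  rewrite !pD ?stabU //; apply/subr0_eq.
  by rewrite -(daddv_pi_eq0 capTW (commQ _ _ _ (Qb i) (Qb j) Ut)) linearB.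
pose z := \sum_i c 0 i *: b`_i.
have Qz : z \in Q by apply: rpred_sum => i _; apply: rpredZ.
have defFz : \sum_i c 0 i *: F b`_i = F z.
  apply/lfunP => t; apply: val_inj; rewrite /= FE sum_lfunE /z.
  rewrite !linear_sum sum_lfunE linear_sum; apply: eq_bigr => i _.
  by rewrite scale_lfunE linearZ /= FE linearZ scale_lfunE linearZ.
have z0 : z = 0.
  apply: nilQ => //; exists m; rewrite -defU.
  apply/(comp_daddv_pi_nilpotent capTW) => [x|x|x Tx]; rewrite ?defU.
  - exact: stabU.
  - exact: stabW.
  transitivity (vsval (iter m (F z) (Subvs Tx))); last by rewrite -defFz nilc.
  by elim: (m) => //= k ->; rewrite comp_lfunE FE.
case/negP: c0; apply/eqP/rowP => i; rewrite mxE.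
by have /freeP/(_ (c 0) z0) := basis_free (vbasisP Q).
Qed.

End CommutingOnQuotient.

(** * Graded subspaces and their brackets *)

Section GradedSubspaces.
Variables (K : numFieldType) (L : lieSuperalgType K).
Implicit Types (U W I : {vspace L}) (x y z : L).

(** Convertible to [evenpart U] at [false] and to [oddpart U] at [true], so that both parities can
    be treated at once. *)
Definition gradepart i U : {vspace L} := (U :&: grade i)%VS.

Lemma gradedP U : graded U <-> (U <= evenpart U + oddpart U)%VS.
Proof.
split=> [{1}-> //|sU]; apply: subv_anti; rewrite sU subv_add.
by rewrite !capvSl.
Qed.

Lemma graded_sub U (P : {vspace L}) :
  graded U -> (forall i, (gradepart i U <= P)%VS) -> (U <= P)%VS.
Proof. by move=> gU sP; rewrite gU subv_add (sP false) (sP true). Qed.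

Lemma homogeneous_grade x i j :
  x \in grade i -> x \in grade j -> i != j -> x = 0.
Proof.
move=> xi xj neq_ij; apply/eqP; rewrite -memv0 -(grade_cap (s := L)) memv_cap.
by case: i j xi xj neq_ij => [] [] // -> ->.
Qed.

Lemma bracketDl x y z : bracket (x + y) z = bracket x z + bracket y z.
Proof. exact: (raddfD (bracketr z)). Qed.

Lemma bracketDr x y z : bracket z (x + y) = bracket z x + bracket z y.
Proof. exact: (raddfD (bracket z)). Qed.

Lemma bracketZr a x y : bracket y (a *: x) = a *: bracket y x.
Proof. exact: (linearZ_LR (bracket y)). Qed.

Lemma bracketNr x y : bracket y (- x) = - bracket y x.
Proof. exact: (raddfN (bracket y)). Qed.

Lemma bracketvS U U' W W' :
  (U <= U')%VS -> (W <= W')%VS -> (bracketv U W <= bracketv U' W')%VS.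
Proof.
move=> sU sW; apply: bracketv_sub => u w Uu Ww.
by apply: memv_bracket; [apply: (subvP sU) | apply: (subvP sW)].
Qed.

(** With one argument fixed, the values of the other whose bracket falls in [I] form a subspace, so
    homogeneous arguments suffice, one variable at a time. *)
Lemma bracketv_sub_graded U W I : graded U -> graded W ->
    (forall i j, {in gradepart i U & gradepart j W,
       forall u w, bracket u w \in I}) ->
  (bracketv U W <= I)%VS.
Proof.
move=> gU gW sI; apply: bracketv_sub => u w Uu Ww.
rewrite -[bracket u w](lfunE (bracketr w)) memv_preim.
apply: (subvP _ _ Uu); apply: (graded_sub gU) => i.
apply/subvP => {u Uu} u Uu; rewrite -memv_preim lfunE /= /bracketr.
rewrite -[bracket u w](lfunE (bracket u)) memv_preim.
apply: (subvP _ _ Ww); apply: (graded_sub gW) => j.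
apply/subvP => {w Ww} w Ww; rewrite -memv_preim lfunE /=.
exact: sI Uu Ww.
Qed.

Lemma memv_gradepart U i x : x \in gradepart i U ->
  x \in (evenpart U + oddpart U)%VS.
Proof.
by case: i => Ux; [apply: (subvP (addvSr _ _)) | apply: (subvP (addvSl _ _))].
Qed.

Lemma graded_bracketv U W : graded U -> graded W -> graded (bracketv U W).
Proof.
move=> gU gW; apply/gradedP; apply: bracketv_sub_graded => // i j u w.
rewrite !memv_cap => /andP[Uu ui] /andP[Ww wj].
apply: (@memv_gradepart _ (i (+) j)).
by rewrite memv_cap memv_bracket // bracket_grade.
Qed.

(** This is the super Jacobi identity for subspaces, which absorb the signs. *)
Lemma bracketv_jacobi U V W : graded U -> graded V -> graded W ->
  (bracketv U (bracketv V W) <=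
     bracketv (bracketv U V) W + bracketv (bracketv U W) V)%VS.
Proof.
move=> gU gV gW; set I := (_ + _)%VS; apply: bracketv_sub => u vw Uu VWvw.
rewrite -[bracket u _](lfunE (bracketr vw)) memv_preim.
apply: (subvP _ _ Uu); apply: (graded_sub gU) => i.
apply/subvP => {u Uu} u; rewrite memv_cap => /andP[Uu ui].
rewrite -memv_preim lfunE /= /bracketr.
rewrite -[bracket u vw](lfunE (bracket u)) memv_preim.
apply: (subvP _ _ VWvw); apply: bracketv_sub_graded => // j k v w.
rewrite !memv_cap => /andP[Vv vj] /andP[Ww wk]; rewrite -memv_preim lfunE /=.
have := bracket_jacobi _ _ _ _ _ _ ui vj wk.
rewrite -addrA => /(canRL (addrK _)); rewrite sub0r.
(* A sign squares to 1, so multiplying by it isolates the bracket of [u] with that of [v] and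
   [w]. *)
move=> /(congr1 ( *:%R ((-1) ^+ (i && k)))).
rewrite scalerA -expr2 sqrr_sign scale1r => ->.
rewrite rpredZ // rpredN rpredD //; apply: rpredZ.
  rewrite (bracket_skew _ _ _ _ vj (bracket_grade _ _ _ _ wk ui)) rpredN.
  apply: rpredZ.
  apply: (subvP (addvSr _ _)); apply: memv_bracket => //.
  by rewrite (bracket_skew _ _ _ _ wk ui) rpredN rpredZ // memv_bracket.
rewrite (bracket_skew _ _ _ _ wk (bracket_grade _ _ _ _ ui vj)) rpredN.
by apply: rpredZ; apply: (subvP (addvSl _ _)); rewrite !memv_bracket.
Qed.

(** For homogeneous [x] and [y] this is the Jacobi identity, whose signs cancel because [z] is even;
    bilinearity gives the rest. *)
Lemma ad_derivation z x y : z \in grade false ->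
  ad z (bracket x y) = bracket (ad z x) y + bracket x (ad z y).
Proof.
move=> z0; rewrite !adE.
suff hom i j u w : u \in grade i -> w \in grade j ->
    bracket (bracket u w) z = bracket (bracket u z) w + bracket u (bracket w z).
  have [x0 hx0 [x1 hx1 ->]] : exists2 x0, x0 \in grade false &
      exists2 x1, x1 \in grade true & x = x0 + x1.
    by apply/memv_addP; rewrite grade_sum memvf.
  have [y0 hy0 [y1 hy1 ->]] : exists2 y0, y0 \in grade false &
      exists2 y1, y1 \in grade true & y = y0 + y1.
    by apply/memv_addP; rewrite grade_sum memvf.
  rewrite !(bracketDl, bracketDr).
  rewrite (hom _ _ _ _ hx0 hy0) (hom _ _ _ _ hx0 hy1).
  rewrite (hom _ _ _ _ hx1 hy0) (hom _ _ _ _ hx1 hy1).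
  (* Each of the four homogeneous brackets has produced two terms: the first ones are gathered into
     $[[x,z],y]$, the second ones into $[x,[y,z]]$. *)
  by rewrite [LHS](AC ((2*2)*(2*2)) ((1*5*(3*7))*(2*4*(6*8)))) /=.
move=> ui wj; have := bracket_jacobi _ _ _ _ _ _ ui wj z0.
rewrite andbF /= expr0 !scale1r (bracket_skew _ _ _ _ z0 ui) /= expr0 scale1r.
rewrite (bracket_skew _ _ _ _ z0 (bracket_grade _ _ _ _ ui wj)) /= expr0.
rewrite scale1r bracketNr (bracket_skew _ _ _ _ wj (bracket_grade _ _ _ _ ui z0)).
rewrite addbF opprK scalerA -expr2 sqrr_sign scale1r => /subr0_eq <-.
by rewrite addrC.
Qed.

End GradedSubspaces.

Section IterLfun.
Variables (K : fieldType) (V : vectType K).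

(** As an endomorphism, the iterate has subspace images and preimages. *)
Definition iter_lfun (f : 'End(V)) k : 'End(V) :=
  iter k (fun g => f \o g)%VF \1%VF.

Lemma iter_lfunE f k x : iter_lfun f k x = iter k f x.
Proof.
by elim: k => [|k IHk]; rewrite /iter_lfun /= ?id_lfunE // comp_lfunE IHk.
Qed.

End IterLfun.

(** * Even derivations and the lower central series *)

Section EvenDerivations.
Variables (K : numFieldType) (L : lieSuperalgType K).
Implicit Types (U W I N : {vspace L}) (x y z : L).

(** Makes [ad] a linear family of operators, as [dim_comm_quot_le] requires. *)
Lemma ad_linear : linear (@ad K L).
Proof.
move=> a y z; apply/lfunP => x.
by rewrite add_lfunE scale_lfunE !adE bracketDr bracketZr.
Qed.

HB.instance Definition _ :=
  GRing.isLinear.Build K L 'End(L) *:%R (@ad K L) ad_linear.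

(** The derivation rule applied to $[x,z]$. Once $[z,y]$ is known to lie in [N], the operators
    commute modulo brackets with [N]. *)
Lemma ad_commutator y z x : y \in grade false ->
  ad y (ad z x) - ad z (ad y x) = bracket x (ad y z).
Proof.
by move=> y0; rewrite {1}(adE z) ad_derivation // !adE addrC addKr.
Qed.

Definition ad_stable z U := {in U, forall x, ad z x \in U}.

Lemma ad_stable_bracketv z U W : z \in grade false ->
  ad_stable z U -> ad_stable z W -> ad_stable z (bracketv U W).
Proof.
move=> z0 sU sW x UWx; rewrite memv_preim; apply: (subvP _ _ UWx).
apply: bracketv_sub => u w Uu Ww; rewrite -memv_preim ad_derivation //.
by rewrite rpredD // memv_bracket // ?sU ?sW.
Qed.

(** Each term of the Leibniz expansion applies [ad z] at least [p] times to [u] or at least [q]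
    times to [w]. The double induction avoids binomial coefficients and uses stability of [I] in
    place of that of [U'] and [W']. *)
Lemma iter_ad_bracket z U U' W W' I p q u w : z \in grade false ->
    ad_stable z U -> ad_stable z W -> ad_stable z I ->
    (bracketv U' W <= I)%VS -> (bracketv U W' <= I)%VS ->
    u \in U -> w \in W -> iter p (ad z) u \in U' -> iter q (ad z) w \in W' ->
  iter (p + q) (ad z) (bracket u w) \in I.
Proof.
move=> z0 sU sW sI sU'W sUW'.
have iterI k x : x \in I -> iter k (ad z) x \in I.
  by move=> Ix; elim: k => //= k; apply: sI.
elim: p q u w => [|p IHp] q u w Uu Ww U'u W'w.
  by apply: iterI; apply: (subvP sU'W); apply: memv_bracket.
elim: q u w Uu Ww U'u W'w => [|q IHq] u w Uu Ww U'u W'w.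
  by apply: iterI; apply: (subvP sUW'); apply: memv_bracket.
rewrite addnS iterSr ad_derivation // iter_lfunD rpredD //.
  by rewrite addSnnS IHp ?sU // -iterSr.
by rewrite IHq ?sW // -iterSr.
Qed.

Lemma lcsS U n : lcs U n.+1 = bracketv (lcs U n) U.
Proof. by []. Qed.

Lemma lcs_addn_sub U k n :
  (bracketv U U <= U)%VS -> (lcs U (k + n) <= lcs U n)%VS.
Proof.
move=> sUU; elim: k => [|k IHk]; first exact: subvv.
apply: subv_trans _ IHk; rewrite addSn.
elim: (k + n)%N => [|m IHm]; first exact: sUU.
by rewrite lcsS (lcsS U m) bracketvS.
Qed.

Lemma graded_lcs N n : graded N -> graded (lcs N n).
Proof. by move=> gN; elim: n => //= n; move/graded_bracketv; apply. Qed.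

(** * Nilpotency of [N + <[z]>] *)

Section NilpotentExtension.
Variables (N : {vspace L}) (z : L).
Hypotheses (gN : graded N) (z0 : z \in grade false) (zN : ad_stable z N).
Hypothesis nil_gen :
  exists m, {in N, forall x, iter m (ad z) x \in bracketv N N}.

Lemma ad_stable_lcs n : ad_stable z (lcs N n).
Proof. by elim: n => //= n IHn; apply: ad_stable_bracketv. Qed.

(** The bracket maps the [n]-th factor of the series times [N / [N, N]] to a spanning set of the
    next factor, and the exponents of nilpotency add up. *)
Lemma ad_nilpotent_lcs n :
  exists m, {in lcs N n, forall x, iter m (ad z) x \in lcs N n.+1}.
Proof.
have [m0 nil0] := nil_gen; elim: n => [|n [m nilm]]; first by exists m0.
exists (m + m0)%N => x; rewrite -iter_lfunE memv_preim; apply: subvP x.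
apply: bracketv_sub => u w Un Nw; rewrite -memv_preim iter_lfunE.
apply: (@iter_ad_bracket _ (lcs N n) (lcs N n.+1) N (bracketv N N)) => //.
- exact: ad_stable_lcs.
- exact: (@ad_stable_lcs n.+2).
(* By Jacobi, bracketing [lcs N n] with $[N,N]$ lands two steps further down. *)
- apply: subv_trans (bracketv_jacobi _ _ _) _ => //; first exact: graded_lcs.
  by rewrite subv_add subvv.
- exact: nilm.
- exact: nil0.
Qed.

(* [N] kills [lcs N n] modulo [lcs N n.+1], so on that quotient iterated
   brackets with [N + <[z]>] are powers of [ad z]. *)
Lemma lcs_add_line (I := (N + <[z]>)%VS) n :
  (bracketv I I <= N)%VS -> exists k, (lcs I k <= lcs N n)%VS.
Proof.
move=> sIIN; have sII := subv_trans sIIN (addvSl N <[z]>%VS).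
(* [lcs I 1] is $[I,I]$, which lies in [N], that is [lcs N 0]. *)
elim: n => [|n [k sk]]; first by exists 1%N.
have [m nilm] := ad_nilpotent_lcs n.
(* Modulo [lcs N n.+1], only the image of the [j]-th power of [ad z] survives; at [j = m] it is
   absorbed too. *)
have step j : (lcs I (j + k) <=
    iter_lfun (ad z) j @: lcs N n + lcs N n.+1)%VS.
  elim: j => [|j IHj].
    rewrite (subv_trans sk) // (subv_trans _ (addvSl _ _)) //.
    by rewrite /iter_lfun lim1g.
  rewrite addSn lcsS; apply: bracketv_sub => u w ujk.
  case/memv_addP=> y Ny [_ /vlineP[a ->] ->].
  have un : u \in lcs N n.
    by apply: (subvP sk); apply: (subvP (lcs_addn_sub j k sII)).
  rewrite bracketDr bracketZr -(adE z) rpredD //.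
    by apply: (subvP (addvSr _ _)); rewrite lcsS memv_bracket.
  rewrite rpredZ //; have /memv_addP[_ /memv_imgP[x xn ->] [v vn ->]] :=
    subvP IHj _ ujk.
  rewrite linearD memv_add ?(@ad_stable_lcs n.+1) //.
  by apply/memv_imgP; exists x => //; rewrite /iter_lfun comp_lfunE.
exists (m + k)%N; apply: subv_trans (step m) _; rewrite subv_add subvv andbT.
by apply/subvP => _ /memv_imgP[x xn ->]; rewrite iter_lfunE nilm.
Qed.

Lemma nilpotent_add_line : (bracketv (N + <[z]>) (N + <[z]>) <= N)%VS ->
  nilpotent N -> nilpotent (N + <[z]>)%VS.
Proof.
move=> sIIN [n nilN]; have [k] := lcs_add_line n sIIN.
by rewrite nilN subv0 => /eqP; exists k.
Qed.

End NilpotentExtension.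

(** [N + <[z]>] is graded since [z] is even, an ideal since it contains $[L,L]$, and nilpotent;
    maximality makes it equal to [N]. *)
Lemma nilradical_mem N z :
    (bracketv {:L} {:L} <= N)%VS -> nilradical N -> z \in grade false ->
    (exists m, {in N, forall x, iter m (ad z) x \in bracketv N N}) ->
  z \in N.
Proof.
move=> sLLN [[gN idN] nilN maxN] z0 nilz.
have sN : (N <= N + <[z]>)%VS by apply: addvSl.
suff <- : (N + <[z]>)%VS = N by rewrite (subvP (addvSr _ _)) ?memv_line.
apply: maxN => //.
  split; last by apply: subv_trans sN; apply: subv_trans sLLN; apply: bracketvS;
    rewrite ?subvf.
  apply/gradedP; rewrite subv_add {1}gN addvS ?capvS //=.
  rewrite -memvE (@memv_gradepart _ _ _ false) // memv_cap z0 andbT.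
  by rewrite (subvP (addvSr _ _)) ?memv_line.
apply: nilpotent_add_line => //.
  move=> x Nx; rewrite adE; apply: (subvP idN).
  by apply: memv_bracket; rewrite ?memvf.
by apply: subv_trans sLLN; apply: bracketvS; rewrite subvf.
Qed.

End EvenDerivations.

(** * Even generators and the even quotient *)

Section Generators.
Variables (K : numFieldType) (L : lieSuperalgType K).
Implicit Types (U W N : {vspace L}) (x z : L) (e : seq L).

(** The odd summand of an even element is here a difference of even elements, hence zero. *)
Lemma evenpart_sub U W :
  (U <= W + grade true)%VS -> (W <= grade false)%VS -> (evenpart U <= W)%VS.
Proof.
move=> sU sW; apply/subvP => x; rewrite memv_cap => /andP[Ux x0].
have /memv_addP[a Wa [b b1 defx]] := subvP sU _ Ux.
have b0 : b \in grade false.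
  by rewrite -[b](addKr a) -defx rpredD // rpredN (subvP sW).
by rewrite defx (homogeneous_grade b0 b1) // addr0.
Qed.

Lemma even_decomposables_sub_grade N :
  (even_decomposables N <= grade false)%VS.
Proof.
rewrite subv_add; apply/andP; split; apply: bracketv_sub => u w;
  rewrite !memv_cap => /andP[_ ui] /andP[_ wi];
  exact: bracket_grade ui wi.
Qed.

Lemma even_decomposables_sub_bracketv N :
  (even_decomposables N <= bracketv N N)%VS.
Proof. by rewrite subv_add !bracketvS ?capvSl. Qed.

(** Brackets of homogeneous elements of opposite parity are odd, so only those of equal parity
    contribute. *)
Lemma evenpart_bracketv N : graded N ->
  evenpart (bracketv N N) = even_decomposables N.
Proof.
move=> gN; apply: subv_anti; apply/andP; split; last first.
  by rewrite subv_cap even_decomposables_sub_bracketv /=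
    even_decomposables_sub_grade.
apply: evenpart_sub (even_decomposables_sub_grade N).
apply: bracketv_sub_graded => // i j u w Nu Nw.
have uw : bracket u w \in grade (i (+) j).
  by move: Nu Nw; rewrite !memv_cap => /andP[_ ui] /andP[_ wj];
    apply: bracket_grade.
case: i j Nu Nw uw => [] [] Nu Nw /= uw;
  by [apply: (subvP (addvSr _ _)) |
      apply: (subvP (addvSl _ _)); apply: (subvP (addvSr _ _));
        apply: memv_bracket |
      apply: (subvP (addvSl _ _)); apply: (subvP (addvSl _ _));
        apply: memv_bracket].
Qed.

(** Adaptedness at [lcs N 1] says that the basis vectors inside $[N,N]$ span it; by freeness the
    remaining ones span a subspace independent of it. *)
Lemma even_generators_cap N e : adapted_basis N e ->
  (<<even_generators N e>> :&: even_decomposables N = 0)%VS.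
Proof.
case=> bN _ /(_ 1%N) /span_basis span1.
pose a := [pred v | v \in bracketv N N].
have: free (filter (predC a) e ++ filter a e).
  rewrite (@perm_free _ _ _ e) ?(basis_free bN) //.
  by rewrite perm_catC; apply/permPl/perm_filterC.
rewrite cat_free => /and3P[_ _ /directv_addP cap0].
apply/eqP; rewrite -subv0 -cap0 capvS //.
  apply: sub_span => v; rewrite !mem_filter /= => /andP[/andP[_ ->]].
  by move->.
by rewrite span1; apply: even_decomposables_sub_bracketv.
Qed.

Lemma even_decomposables_sub_evenpart N :
  (bracketv N N <= N)%VS -> (even_decomposables N <= evenpart N)%VS.
Proof.
move=> sNN; rewrite subv_cap even_decomposables_sub_grade andbT.
exact: subv_trans (even_decomposables_sub_bracketv N) sNN.
Qed.

(** A basis vector is odd, or an even generator, or even and in $[N,N]$, hence in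
    [even_decomposables N]. *)
Lemma even_generators_add N e :
    graded N -> (bracketv N N <= N)%VS -> adapted_basis N e ->
  (<<even_generators N e>> + even_decomposables N = evenpart N)%VS.
Proof.
move=> gN sNN [bN /allP homog_e _].
set X := <<_>>%VS; set D := even_decomposables N.
have sX : (X <= evenpart N)%VS.
  apply/span_subvP => v; rewrite mem_filter => /andP[/andP[v0 _] ev].
  by rewrite memv_cap v0 (basis_mem bN).
have sD : (D <= evenpart N)%VS by apply: even_decomposables_sub_evenpart.
apply: subv_anti; rewrite subv_add sX sD /=.
apply: evenpart_sub; last first.
  by rewrite subv_add (subv_trans sX (capvSr _ _)) (subv_trans sD (capvSr _ _)).
rewrite -{1}(span_basis bN); apply/span_subvP => v ev.
case/orP: (homog_e v ev) => [v0|v1]; last exact: (subvP (addvSr _ _)).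
apply: (subvP (addvSl _ _)); have [NNv|NNv] := boolP (v \in bracketv N N).
  by apply: (subvP (addvSr _ _)); rewrite /D -evenpart_bracketv // memv_cap NNv.
by apply: (subvP (addvSl _ _)); rewrite memv_span // mem_filter v0 NNv.
Qed.

(** Turns the condition defining [Q2] into one on the even quotient, free of the basis [e]. *)
Lemma nilpotent_on_ad_gen N e z :
    graded N -> (bracketv N N <= N)%VS -> adapted_basis N e ->
    ad_stable z (evenpart N) -> ad_stable z (even_decomposables N) ->
  nilpotent_on <<even_generators N e>>%VS (ad_gen N e z) <->
  exists m, {in evenpart N, forall x,
    iter m (ad z) x \in even_decomposables N}.
Proof.
move=> gN sNN eN sN sD.
have defN := even_generators_add gN sNN eN.
have equiv m :=
  comp_daddv_pi_nilpotent (even_generators_cap eN) (f := ad z) _ sD m.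
rewrite defN in equiv.
by split=> -[m /(equiv sN) nil_m]; exists m.
Qed.

End Generators.

(** * The bounds on [Q1] and [Q2] *)

Theorem theorem3p18 (R : realType) (L : lieSuperalgType R[i])
    (N Q0 Q1 Q2 : {vspace L}) (e : seq L)
    (solvL : solvable {: L}%VS)
    (non_nilpL : ~ nilpotent {: L}%VS)
    (nilradN : nilradical N)
    (derivedN : (bracketv {: L}%VS {: L}%VS <= N)%VS)
    (evenQ0 : (Q0 <= grade false)%VS)
    (complQ0 : complementv N Q0 {: L}%VS)
    (basisN : adapted_basis N e)
    (Q2P : forall z : L, z \in Q2 <->
       z \in Q0 /\ nilpotent_on <<even_generators N e>>%VS (ad_gen N e z))
    (complQ1 : complementv Q1 Q2 Q0) :
  (\dim Q1 <= \dim (quotv (evenpart N)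
     (bracketv (evenpart N) (evenpart N) + bracketv (oddpart N) (oddpart N))%VS))%N
  /\
  (\dim Q2 <= \dim (quotv (oddpart N) (bracketv (oddpart N) (evenpart N))))%N.
Proof.
have [[gN idN] _ _] := nilradN.
have [[_ capNQ] [sumQ capQ]] := (complQ0, complQ1).
have sQ1 : (Q1 <= Q0)%VS by rewrite -sumQ addvSl.
have sQ2 : (Q2 <= Q0)%VS by rewrite -sumQ addvSr.
have sN x y : x \in N -> bracket x y \in N.
  by move=> Nx; apply: (subvP idN); apply: memv_bracket; rewrite ?memvf.
have sPart i z : z \in grade false -> ad_stable z (gradepart i N).
  move=> z0 x; rewrite adE !memv_cap => /andP[Nx xi].
  by rewrite sN //= -(addbF i) bracket_grade.
(* The commutator is a bracket of [x] with $[z,y]$, which is even and lies in $[L,L]$, hence in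
   [N]. *)
have comm i y z x : y \in grade false -> z \in grade false ->
    x \in gradepart i N ->
    ad y (ad z x) - ad z (ad y x) \in bracketv (gradepart i N) (evenpart N).
  move=> y0 z0 Nx; rewrite ad_commutator // memv_bracket //.
  rewrite adE memv_cap (@bracket_grade _ _ false false) // andbT.
  by apply: (subvP derivedN); apply: memv_bracket; rewrite memvf.
have even z : z \in Q0 -> z \in grade false by move/(subvP evenQ0).
have sDec z : z \in grade false -> ad_stable z (even_decomposables N).
  move=> z0 x; case/memv_addP=> u Uu [v Vv ->]; rewrite linearD memv_add //.
    by apply: ad_stable_bracketv (sPart false z z0) (sPart false z z0) _ Uu.
  by apply: ad_stable_bracketv (sPart true z z0) (sPart true z z0) _ Vv.
have sNN : (bracketv N N <= N)%VS.
  by apply: bracketv_sub => x y Nx _; apply: sN.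
have nilP z : z \in grade false ->
    nilpotent_on <<even_generators N e>>%VS (ad_gen N e z) <->
    exists m, {in evenpart N, forall x,
      iter m (ad z) x \in even_decomposables N}.
  move=> z0; apply: nilpotent_on_ad_gen => //; last exact: sDec.
  exact: (sPart false).
split.
  apply: (@dim_comm_quot_le _ _ _ (@ad _ L)).
  - exact: even_decomposables_sub_evenpart.
  - by move=> z x /(subvP sQ1)/even z0; apply: (sPart false z z0).
  - by move=> z x /(subvP sQ1)/even z0; apply: (sDec z z0).
  - move=> y z x /(subvP sQ1)/even y0 /(subvP sQ1)/even z0 Nx.
    by apply: (subvP (addvSl _ _)); apply: (comm false).
  (* Nilpotency on the even quotient puts [z] in [Q2], which meets [Q1] trivially. *)
  move=> z Q1z nilz; have Q0z := subvP sQ1 _ Q1z.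
  apply/eqP; rewrite -memv0 -capQ memv_cap Q1z; apply/Q2P.
  by split=> //; apply/nilP; first exact: even.
apply: (@dim_comm_quot_le _ _ _ (@ad _ L)).
- apply: bracketv_sub => u w; rewrite !memv_cap => /andP[Nu u1] /andP[_ w0].
  by rewrite sN // (@bracket_grade _ _ true false).
- by move=> z x /(subvP sQ2)/even z0; apply: (sPart true z z0).
- move=> z x /(subvP sQ2)/even z0.
  by apply: ad_stable_bracketv z0 (sPart true z z0) (sPart false z z0) _.
- move=> y z x /(subvP sQ2)/even y0 /(subvP sQ2)/even z0 Nx.
  exact: (comm true).
move=> z /Q2P[Q0z]; have z0 := even _ Q0z.
case/(nilP _ z0) => m0 nil0 [m1 nil1].
apply/eqP; rewrite -memv0 -capNQ memv_cap Q0z andbT.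
(* [m0] iterations send the even part of [N] into $[N,N]$ and [m1] the odd part; the remaining ones
   stay there, so the sum serves both. *)
apply: nilradical_mem => //; exists (m0 + m1)%N.
have iterNN k x : x \in bracketv N N -> iter k (ad z) x \in bracketv N N.
  move=> NNx; elim: k => //= k; apply: ad_stable_bracketv => // y Ny;
    by rewrite adE sN.
move=> x Nx; rewrite -iter_lfunE memv_preim; apply: (subvP _ _ Nx).
apply: (graded_sub gN) => i; apply/subvP => {x Nx} x Nx.
rewrite -memv_preim iter_lfunE; case: i Nx => Nx.
  by rewrite iterD iterNN // (subvP _ _ (nil1 x Nx)) // bracketvS ?capvSl.
rewrite addnC iterD iterNN //.
exact: (subvP (even_decomposables_sub_bracketv N) _ (nil0 x Nx)).
Qed.
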